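(* Let $R$ be an arithmetic ring. Then: (1) $\lambda\text{-}\dim(R)\le 3$; (2) if moreover $R$ is reduced, then $\lambda\text{-}\dim(R)\le 2$.
   Context: All rings are commutative with identity. A ring $R$ is a valuation ring if its ideals are totally ordered by inclusion, and $R$ is arithmetic if $R_M$ is a valuation ring for every maximal ideal $M$ of $R$. An $R$-module $E$ has a finite $n$-presentation if there is an exact sequence $F_n\to F_{n-1}\to\cdots\to F_1\to F_0\to E\to 0$ with each $F_i$ a free $R$-module of finite rank. Put $\lambda_R(E)=\sup\{n : E \text{ has a finite } n\text{-presentation}\}$ (and $\lambda_R(E)=-1$ if $E$ is not finitely generated). The $\lambda$-dimension $\lambda\text{-}\dim(R)$ is the least integer $n$ (or $\infty$ if none exists) such that for every $R$-module $E$, $\lambda_R(E)\ge n$ implies $\lambda_R(E)=\infty$. *)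

(* Defs.v *)
From HB Require Import structures.
From mathcomp Require Import all_boot all_order all_algebra.
Set Implicit Arguments. Unset Strict Implicit. Unset Printing Implicit Defensive.
Import GRing.Theory.
Local Open Scope ring_scope.

Section Defs.
Variable R : comPzRingType.

Definition is_ideal (I : R -> Prop) : Prop :=
  [/\ I 0, (forall x y, I x -> I y -> I (x + y)) & (forall a x, I x -> I (a * x))].

Definition is_maximal_ideal (M : R -> Prop) : Prop :=
  [/\ is_ideal M, ~ M 1 &
      forall J : R -> Prop, is_ideal J -> (forall x, M x -> J x) ->
        (forall x, J x -> M x) \/ J 1].

(* The localization R_M, S = R \ M, is the set of fractions a/s (a : R, s notin M)
   modulo  a/s = b/t  iff  exists u notin M, u (a t - b s) = 0.
   A subset of R_M is represented by a predicate J on pairs (a, s) (only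
   pairs with s notin M are meaningful); it is an ideal of R_M iff it is
   well defined on classes, contains 0/1, is closed under sums and under
   multiplication by elements of R_M. *)
Definition frac_eq (M : R -> Prop) (a s b t : R) : Prop :=
  exists u, ~ M u /\ u * (a * t - b * s) = 0.

Definition is_loc_ideal (M : R -> Prop) (J : R -> R -> Prop) : Prop :=
  [/\ (forall a s b t, ~ M s -> ~ M t -> frac_eq M a s b t -> J a s -> J b t),
      J 0 1,
      (forall a s b t, ~ M s -> ~ M t -> J a s -> J b t -> J (a * t + b * s) (s * t))
    & (forall a s b t, ~ M s -> ~ M t -> J a s -> J (b * a) (t * s))].

Definition loc_is_valuation (M : R -> Prop) : Prop :=
  forall J1 J2, is_loc_ideal M J1 -> is_loc_ideal M J2 ->
    (forall a s, ~ M s -> J1 a s -> J2 a s) \/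
    (forall a s, ~ M s -> J2 a s -> J1 a s).

Definition arithmetic : Prop :=
  forall M, is_maximal_ideal M -> loc_is_valuation M.

Definition reduced : Prop := forall (x : R) (n : nat), x ^+ n = 0 -> x = 0.

(* E has a finite n-presentation F_n -> ... -> F_0 -> E -> 0, with
   F_i = R^(r i) (row vectors), the map F_(i+1) -> F_i given by right
   multiplication by the matrix A i, and g : F_0 -> E linear. *)
Definition has_fin_pres (E : lmodType R) (n : nat) : Prop :=
  exists (r : nat -> nat) (A : forall i : nat, 'M[R]_(r i.+1, r i))
         (g : {linear 'rV[R]_(r 0%N) -> E}),
  [/\ (forall e : E, exists v, g v = e),
      (0 < n)%N -> forall v, g v = 0 <-> exists w, v = w *m A 0%N
    & forall i : nat, (i.+1 < n)%N ->
        forall v : 'rV[R]_(r i.+1), v *m A i = 0 <-> exists w, v = w *m A i.+1].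

(* lambda_R(E) >= n  (for n a natural number; presentations are downward closed). *)
Definition lambda_ge (E : lmodType R) (n : nat) : Prop := has_fin_pres E n.

Definition lambda_inf (E : lmodType R) : Prop := forall n, has_fin_pres E n.

Definition lambda_dim_prop (n : nat) : Prop :=
  forall E : lmodType R, lambda_ge E n -> lambda_inf E.

Definition lambda_dim_le (d : nat) : Prop :=
  exists2 n : nat, (n <= d)%N & lambda_dim_prop n.

End Defs.

(* Main.v *)
(* Over the localization of an arithmetic ring at a maximal ideal every matrix
   can be diagonalized, so in a presentation F_2 -> F_1 -> F_0 the kernels split
   into annihilators of elements. If [(0 : a) = (b)] and [(0 : b) = (c)] then
   [(0 : c) = (b)], and over a reduced ring [(b)] is already generated by an
   idempotent. So after two syzygies (one in the reduced case) the next kernel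
   is locally finitely generated. Localization at M is replaced by denominators:
   statements hold up to a scalar outside M, and "the kernel is finitely
   generated up to s" defines an ideal of scalars s; it is contained in no
   maximal ideal, so it contains 1. *)
Require Import Defs.
From mathcomp Require Import all_boot all_order all_algebra.
From mathcomp Require Import perm ring.
From mathcomp Require Import boolp classical_sets.

Set Implicit Arguments.
Unset Strict Implicit.
Unset Printing Implicit Defensive.

Import GRing.Theory.
Local Open Scope ring_scope.

(** * Maximal ideals and divisibility up to a scalar outside them *)

Section Ideals.
Variable R : comPzRingType.
Implicit Types (a b s x : R) (G M : R -> Prop).

Lemma exists_maximal_ideal G : is_ideal G -> ~ G 1 ->
  exists2 M, is_maximal_ideal M & forall x, G x -> M x.
Proof.
move=> idG G1.
pose T := {J : R -> Prop | [/\ is_ideal J, ~ J 1 & forall x, G x -> J x]}.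
pose leT (J K : T) := `[< forall x, sval J x -> sval K x >].
have leTP (J K : T) : reflect (forall x, sval J x -> sval K x) (leT J K).
  exact: asboolP.
have [||||[M [idM M1 GM]] maxM] := @Zorn T leT.
- by move=> J; apply/leTP.
- by move=> J K L /leTP JK /leTP KL; apply/leTP => x /JK/KL.
- move=> [J HJ] [K HK] /leTP JK /leTP KJ; apply: eq_exist => /=.
  by apply/funext => x; apply/propext; split=> [/JK|/KJ].
- move=> A totA; have [[J0 AJ0]|A0] := pselect (exists J, A J); last first.
    (* The union of the empty chain is empty, so here [G] itself is the upper bound. *)
    exists (exist _ G (And3 idG G1 (fun x Gx => Gx))) => J AJ.
    by case: A0; exists J.
  pose U x := exists2 J, A J & sval J x.
  have idU : is_ideal U.
    split.
    - by exists J0 => //; case: (svalP J0) => -[].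
    - move=> x y [J AJ Jx] [K AK Ky].
      have [/leTP JK|/leTP KJ] := totA _ _ AJ AK.
        by exists K => //; case: (svalP K) => -[_ + _] _ _; apply=> //; apply: JK.
      by exists J => //; case: (svalP J) => -[_ + _] _ _; apply=> //; apply: KJ.
    - by move=> a x [J AJ Jx]; exists J => //; case: (svalP J) => -[_ _ +] _ _; apply.
  have U1 : ~ U 1 by move=> [J AJ J1]; case: (svalP J) => _ /(_ J1).
  have GU x : G x -> U x by move=> Gx; exists J0 => //; case: (svalP J0) => _ _; apply.
  exists (exist _ U (And3 idU U1 GU)) => J AJ.
  by apply/leTP => x Jx; exists J.
exists M => //; split=> // J idJ MJ; have [J1|J1] := pselect (J 1); [by right|left].
have GJ x : G x -> J x by move=> /GM/MJ.
have /(congr1 sval) /= <- // : exist _ J (And3 idJ J1 GJ) = exist _ M (And3 idM M1 GM) :> T.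
by apply: maxM; apply/leTP.
Qed.

Lemma ideal_local_global G : is_ideal G ->
  (forall M, is_maximal_ideal M -> exists2 s, ~ M s & G s) -> G 1.
Proof.
move=> idG locG; apply: contrapT => /(exists_maximal_ideal idG)[M maxM GM].
by have [s Ms /GM] := locG M maxM.
Qed.

Section MaximalIdeal.
Variable M : R -> Prop.
Hypothesis maxM : is_maximal_ideal M.

Lemma maximal_ideal_prime x y : ~ M x -> ~ M y -> ~ M (x * y).
Proof.
case: maxM => -[M0 MD MM] M1 Mmax nMx nMy Mxy.
pose J z := exists m r, M m /\ z = m + r * x.
have idJ : is_ideal J.
  split; first by exists 0, 0; split=> //; ring.
    move=> _ _ [m [r [Mm ->]]] [m' [r' [Mm' ->]]].
    by exists (m + m'), (r + r'); split; [apply: MD | ring].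
  by move=> a _ [m [r [Mm ->]]]; exists (a * m), (a * r); split; [apply: MM | ring].
have MJ z : M z -> J z by move=> Mz; exists z, 0; split=> //; ring.
have [JM|[m [r [Mm E]]]] := Mmax J idJ MJ.
  by apply/nMx/JM; exists 0, 1; split=> //; ring.
apply: nMy; have -> : y = y * m + r * (x * y).
  by rewrite -[LHS]mulr1 E; ring.
by apply: MD; apply: MM.
Qed.

Hypothesis arithR : arithmetic R.

Lemma arithmetic_local_total a b :
  exists2 s, ~ M s & (exists u, s * a = u * b) \/ (exists u, s * b = u * a).
Proof.
have primeM := maximal_ideal_prime.
have nM1 : ~ M 1 by case: maxM.
(* [J c] is the ideal of the localization generated by [c]; the denominator of a fraction is a unit
   there, so it does not affect membership. *)
pose J c x (_ : R) := exists u r, ~ M u /\ u * x = r * c.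
have idJ c : is_loc_ideal M (J c).
  split.
  - move=> x s y t Ms Mt [w [Mw E]] [u [r [Mu Ex]]].
    exists (w * u * s), (w * r * t); split; first exact: primeM (primeM _ _ Mw Mu) Ms.
    transitivity (w * t * (u * x) - u * (w * (x * t - y * s))); first by ring.
    by rewrite E Ex; ring.
  - by exists 1, 0; split=> //; ring.
  - move=> x s y t Ms Mt [u [r [Mu Ex]]] [w [q [Mw Ey]]].
    exists (u * w), (r * w * t + q * u * s); split; first exact: primeM.
    transitivity (w * t * (u * x) + u * s * (w * y)); first by ring.
    by rewrite Ex Ey; ring.
  - move=> x s y t Ms Mt [u [r [Mu Ex]]]; exists u, (y * r); split=> //.
    by rewrite mulrCA Ex; ring.
have self c : J c c 1 by exists 1, 1.
have [/(_ a 1 nM1 (self a))|/(_ b 1 nM1 (self b))] := arithR maxM (idJ a) (idJ b).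
  by move=> [u [r [Mu E]]]; exists u => //; left; exists r.
by move=> [u [r [Mu E]]]; exists u => //; right; exists r.
Qed.

(** Local divisibility is total, so a finite family has a member dividing all others, the
    denominators being multiplied along the way; [i0] makes the family nonempty. *)
Lemma arithmetic_local_pivot (I : finType) (f : I -> R) (i0 : I) :
  exists j s, ~ M s /\ forall i, exists u, s * f i = u * f j.
Proof.
have [j [s [Ms Hs]]] : exists j s, ~ M s /\
    forall i, i \in i0 :: enum I -> exists u, s * f i = u * f j.
  elim: (enum I) => [|k l [j [s [Ms IH]]]].
    exists i0, 1; split=> [|i]; first by case: maxM.
    by rewrite inE => /eqP ->; exists 1.
  have [t Mt [] [u E]] := arithmetic_local_total (f k) (f j).
    exists j, (t * s); split=> [|i]; first exact: maximal_ideal_prime.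
    rewrite !inE orbCA => /predU1P[->|li]; first by exists (s * u); rewrite mulrAC E; ring.
    by have [|w Ew] := IH i; [rewrite inE | exists (t * w); rewrite -mulrA Ew mulrA].
  exists k, (t * s); split=> [|i]; first exact: maximal_ideal_prime.
  rewrite !inE orbCA => /predU1P[->|li]; first by exists (t * s).
  have [|w Ew] := IH i; first by rewrite inE.
  by exists (w * u); rewrite -!mulrA -E Ew mulrCA.
by exists j, s; split=> // i; apply: Hs; rewrite inE mem_enum orbT.
Qed.

End MaximalIdeal.

(** * Global splittings of 1 and annihilators of elements *)

Lemma arithmetic_bezout a b : arithmetic R ->
  exists p u v, p * a = u * b /\ (1 - p) * b = v * a.
Proof.
move=> arithR.
(* [G] is the ideal (b : a) + (a : b); locally one of the two summands already contains a unit. *)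
pose G s := exists p q u v, [/\ s = p + q, p * a = u * b & q * b = v * a].
suff [p [q [u [v [E Ea Eb]]]]] : G 1.
  by exists p, u, v; split=> //; rewrite E addrC addKr.
apply: ideal_local_global.
  split.
  - by exists 0, 0, 0, 0; split; ring.
  - move=> _ _ [p [q [u [v [-> Ea Eb]]]]] [p' [q' [u' [v' [-> Ea' Eb']]]]].
    exists (p + p'), (q + q'), (u + u'), (v + v').
    by rewrite !mulrDl Ea Ea' Eb Eb'; split=> //; ring.
  - move=> c _ [p [q [u [v [-> Ea Eb]]]]].
    by exists (c * p), (c * q), (c * u), (c * v); rewrite -!mulrA Ea Eb mulrDr.
move=> M maxM; have [s Ms [[u E]|[u E]]] := arithmetic_local_total maxM arithR a b.
  by exists s => //; exists s, 0, u, 0; split=> //; ring.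
by exists s => //; exists 0, s, 0, u; split=> //; ring.
Qed.

(* In a valuation ring, if [(0 : b) = (c)] with [b, c] nonzero then
   [(0 : c) = (b)]; hypothesis [hb] covers the degenerate case [c = 0], where
   [b] has to be a unit. *)
Lemma ann_ann s t b c : arithmetic R ->
  (forall x, x * b = 0 -> exists u, s * x = u * c) ->
  (forall e, e * c = 0 -> exists u, t * e = u * b) ->
  forall x, x * c = 0 -> exists u, t * s * x = u * b.
Proof.
move=> arithR annb hb x xc0.
(* Splittings of 1 replace the case distinctions of a valuation ring. The part [p] puts [x] into
   (b). The part [q * (1 - p)] kills [b], so [s] times it lies in (c) and kills [x]. On the part
   [(1 - p) * (1 - q)], the scalar [s] acts as [y' * v] modulo the annihilator of [c], and [v * x]
   is a multiple of [b]. *)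
have [p [u [v [px vx]]]] := arithmetic_bezout x b arithR.
have [q [w [z [qv zc]]]] := arithmetic_bezout v c arithR.
have [|y Ey] := annb (q * (1 - p)).
  transitivity ((1 - p) * b * q); first by ring.
  rewrite vx; transitivity (q * v * x); first by ring.
  rewrite qv; transitivity (w * (x * c)); first by ring.
  by rewrite xc0 mulr0.
have [|y' Ey'] := annb ((1 - p) * z).
  transitivity ((1 - p) * b * z); first by ring.
  rewrite vx; transitivity ((z * v) * x); first by ring.
  rewrite -zc; transitivity ((1 - q) * (x * c)); first by ring.
  by rewrite xc0 mulr0.
have [|k Ek] := hb (s * (1 - p) * (1 - q) - y' * v).
  transitivity (s * (1 - p) * ((1 - q) * c) - y' * v * c); first by ring.
  rewrite zc; transitivity (s * ((1 - p) * z) * v - y' * v * c); first by ring.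
  by rewrite Ey'; ring.
exists (t * s * u + k * x + t * y' * (1 - p)).
transitivity (t * s * (p * x) + t * x * (s * (q * (1 - p)))
   + t * (s * (1 - p) * (1 - q) - y' * v) * x + t * y' * (v * x)); first by ring.
rewrite px Ey Ek -vx.
transitivity ((t * s * u + k * x + t * y' * (1 - p)) * b + t * y * (x * c)); first by ring.
by rewrite xc0; ring.
Qed.

(** As [c * b = 0], the elements [p * b] and [(1 - p) * c] of the splitting have square zero, hence
    vanish: [p] separates [b] from [c]. *)
Lemma reduced_ann_ann s b c : arithmetic R -> reduced R -> c * b = 0 ->
  (forall x, x * b = 0 -> exists u, s * x = u * c) ->
  exists d, d * c = 0 /\ forall x, x * c = 0 -> exists u, s * x = u * d.
Proof.
move=> arithR redR cb0 annb.
have [p [u [v [pb vb]]]] := arithmetic_bezout b c arithR.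
have [|k Ek] := annb p.
  apply: (redR _ 2); transitivity ((p * b) * (p * b)); first by ring.
  by rewrite {1}pb; transitivity (u * p * (c * b)); [ring | rewrite cb0 mulr0].
have pc0 : (1 - p) * c = 0.
  apply: (redR _ 2); transitivity ((1 - p) * c * ((1 - p) * c)); first by ring.
  rewrite {1}vb; transitivity (v * (1 - p) * (c * b)); first by ring.
  by rewrite cb0 mulr0.
(* This is [s * (1 - p)], which kills [c]; written with [k * c], it visibly acts as [s] on every [x]
   with [x * c = 0]. *)
exists (s - k * c); split.
  transitivity (s * ((1 - p) * c) + (s * p - k * c) * c); first by ring.
  by rewrite pc0 Ek; ring.
move=> x xc0; exists x; transitivity (x * (s - k * c) + k * (x * c)); first by ring.
by rewrite xc0; ring.
Qed.

End Ideals.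

(** * Kernels and invertibility of matrices up to a scalar *)

Section Matrices.
Variable R : comPzRingType.

Definition gens_ker (m n p : nat) (B : 'M[R]_(p, m)) (A : 'M[R]_(m, n)) : Prop :=
  forall v : 'rV_m, v *m A = 0 <-> exists w, v = w *m B.

(** The rows of [N] lie in the kernel exactly and only generation is up to [s], so [s = 1] gives
    true generators. Leaving [k] free lets generating families be stacked. *)
Definition ker_fg_upto (m p : nat) (B : 'M[R]_(p, m)) (s : R) : Prop :=
  exists k (N : 'M[R]_(k, p)), N *m B = 0 /\
    forall v : 'rV_p, v *m B = 0 -> exists w, s *: v = w *m N.

(** Invertibility after inverting [s], with the denominator cleared: [P'] is [s] times the inverse
    of [P]. *)
Definition inv_upto (n : nat) (s : R) (P P' : 'M[R]_n) : Prop :=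
  P *m P' = s%:M /\ P' *m P = s%:M.

Lemma gens_ker_mul0 m n p (B : 'M[R]_(p, m)) (A : 'M[R]_(m, n)) :
  gens_ker B A -> B *m A = 0.
Proof.
move=> kerA; apply/row_matrixP => i; rewrite row_mul row0.
by apply/kerA; exists (delta_mx 0 i); rewrite rowE.
Qed.

Lemma ker_fg_upto1 m p (B : 'M[R]_(p, m)) :
  ker_fg_upto B 1 -> exists k (N : 'M[R]_(k, p)), gens_ker N B.
Proof.
move=> [k [N [NB HN]]]; exists k, N => v; split=> [/HN[w]|[w ->]].
  by rewrite scale1r; exists w.
by rewrite -mulmxA NB mulmx0.
Qed.

Lemma ker_fg_upto_ideal m p (B : 'M[R]_(p, m)) : is_ideal (ker_fg_upto B).
Proof.
split.
- exists 0, 0; split=> [|v _]; first by rewrite mul0mx.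
  by exists 0; rewrite scale0r mulmx0.
- move=> s t [k [N [NB HN]]] [l [L [LB HL]]].
  exists (k + l)%N, (col_mx N L); rewrite mul_col_mx NB LB col_mx0.
  split=> // v vB; have [w Ew] := HN v vB; have [u Eu] := HL v vB.
  by exists (row_mx w u); rewrite mul_row_col scalerDl Ew Eu.
- move=> a s [k [N [NB HN]]]; exists k, N; split=> // v vB.
  by have [w Ew] := HN v vB; exists (a *: w); rewrite -scalerA Ew scalemxAl.
Qed.

Lemma inv_upto_mul n s t (P P' Q Q' : 'M[R]_n) :
  inv_upto s P P' -> inv_upto t Q Q' -> inv_upto (s * t) (P *m Q) (Q' *m P').
Proof.
move=> [PP' P'P] [QQ' Q'Q]; split.
  by rewrite mulmxA -(mulmxA P) QQ' mul_mx_scalar -scalemxAl PP' scale_scalar_mx mulrC.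
by rewrite mulmxA -(mulmxA Q') P'P mul_mx_scalar -scalemxAl Q'Q scale_scalar_mx.
Qed.

Lemma inv_upto_tperm n (i j : 'I_n) :
  inv_upto 1 (tperm_mx i j : 'M[R]_n) (tperm_mx i j).
Proof. by split; rewrite -perm_mxM tperm2 perm_mx1. Qed.

(** Row elimination with multipliers [V / s], each lower row being scaled by [s] to clear
    denominators. *)
Lemma inv_upto_lower n s (V : 'cV[R]_n) :
  inv_upto s (block_mx 1%:M 0 (- V) s%:M) (block_mx s%:M 0 V 1%:M).
Proof.
by split; rewrite mulmx_block !(mul1mx, mulmx1, mul0mx, mulmx0, add0r, addr0)
  ?mul_mx_scalar ?mul_scalar_mx ?scalerN ?addNr ?addrN -scalar_mx_block.
Qed.

Lemma inv_upto_upper n s (U : 'rV[R]_n) :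
  inv_upto s (block_mx 1%:M (- U) 0 s%:M) (block_mx s%:M U 0 1%:M).
Proof.
by split; rewrite mulmx_block !(mul1mx, mulmx1, mul0mx, mulmx0, add0r, addr0)
  ?mul_mx_scalar ?mul_scalar_mx ?scalerN ?addNr ?addrN -scalar_mx_block.
Qed.

Lemma inv_upto_block n s (P P' : 'M[R]_n) :
  inv_upto s P P' -> inv_upto s (block_mx (1%:M : 'M_1) 0 0 P) (block_mx s%:M 0 0 P').
Proof.
by move=> [PP' P'P]; split;
  rewrite mulmx_block !(mul1mx, mulmx1, mul0mx, mulmx0, add0r, addr0) ?PP' ?P'P
    -scalar_mx_block.
Qed.

Definition diag_upto m n (A : 'M[R]_(m, n)) (s t : R) : Prop :=
  exists (P P' : 'M[R]_m) (Q Q' : 'M[R]_n),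
    [/\ inv_upto s P P', inv_upto t Q Q' & is_diag_mx (P *m A *m Q)].

Lemma diag_upto_equiv m n (A : 'M[R]_(m, n)) P P' Q Q' s t s' t' :
  inv_upto s P P' -> inv_upto t Q Q' -> diag_upto (P *m A *m Q) s' t' ->
  diag_upto A (s' * s) (t * t').
Proof.
move=> invP invQ [P1 [P1' [Q1 [Q1' [invP1 invQ1 diagA]]]]].
exists (P1 *m P), (P' *m P1'), (Q *m Q1), (Q1' *m Q'); split.
- exact: inv_upto_mul.
- exact: inv_upto_mul.
- by move: diagA; rewrite !mulmxA.
Qed.

Lemma diag_upto_block m n (a : 'M[R]_1) (A : 'M[R]_(m, n)) s t :
  diag_upto A s t -> diag_upto (block_mx a 0 0 A) s t.
Proof.
move=> [P [P' [Q [Q' [invP invQ diagA]]]]].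
exists (block_mx 1%:M 0 0 P), (block_mx s%:M 0 0 P').
exists (block_mx 1%:M 0 0 Q), (block_mx t%:M 0 0 Q').
split; try exact: inv_upto_block.
rewrite !mulmx_block !(mul1mx, mulmx1, mul0mx, mulmx0, add0r, addr0).
by rewrite is_diag_block_mx // !eqxx diagA mx11_is_diag.
Qed.

(** * Diagonalization and kernels near one maximal ideal *)

Section Local.
Variable M : R -> Prop.
Hypothesis maxM : is_maximal_ideal M.

Let nM1 : ~ M 1. Proof. by case: maxM. Qed.
Let nMM x y : ~ M x -> ~ M y -> ~ M (x * y).
Proof. exact: maximal_ideal_prime. Qed.

(** The product of the finitely many scalars works for all indices and stays outside the prime
    [M]. *)
Lemma local_common (I : finType) (F : I -> R -> Prop) :
  (forall i a s, F i s -> F i (a * s)) -> (forall i, exists2 s, ~ M s & F i s) ->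
  exists2 s, ~ M s & forall i, F i s.
Proof.
move=> FM Fex; suff [s Ms Fs] : exists2 s, ~ M s & forall i, i \in enum I -> F i s.
  by exists s => // i; apply: Fs; rewrite mem_enum.
elim: (enum I) => [|i l [s Ms IH]]; first by exists 1.
have [t Mt Ft] := Fex i; exists (s * t); first exact: nMM.
move=> j; rewrite inE => /predU1P[->|/IH Fj]; first exact: FM.
by rewrite mulrC; apply: FM.
Qed.

Hypothesis arithR : arithmetic R.

(** Gaussian elimination: an entry dividing all others up to [s] is moved to the corner, clears its
    row and column, and the remaining block is treated by induction. *)
Lemma arithmetic_diag_local m n (A : 'M[R]_(m, n)) :
  exists s t, [/\ ~ M s, ~ M t & diag_upto A s t].
Proof.
have trivial_diag m' n' (B : 'M[R]_(m', n')) : is_diag_mx B ->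
    exists s t, [/\ ~ M s, ~ M t & diag_upto B s t].
  exists 1, 1; split=> //; exists 1%:M, 1%:M, 1%:M, 1%:M.
  by rewrite /inv_upto !mul1mx !mulmx1; split.
elim: m n A => [|m IH] [|n] A.
- by apply/trivial_diag/is_diag_mxP => -[].
- by apply/trivial_diag/is_diag_mxP => -[].
- by apply/trivial_diag/is_diag_mxP => ? [].
have [[i j] [s [Ms /choice[/= f Hf]]]] :=
  arithmetic_local_pivot maxM arithR (fun k : 'I_m.+1 * 'I_n.+1 => A k.1 k.2) (0, 0).
have [A1 A1def] : exists A1 : 'M_(1 + m, 1 + n), A1 = tperm_mx 0 i *m A *m tperm_mx 0 j.
  by eexists.
(* [W] holds the quotients of the entries by the pivot, up to [s]; its border gives the multipliers
   [U] and [V]. *)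
have [W HW] : exists W : 'M_(1 + m, 1 + n), forall k l, s * A1 k l = W k l * A1 0 0.
  have A1E k l : A1 k l = A (tperm 0 i k) (tperm 0 j l).
    by rewrite A1def -xrowE -xcolE !mxE.
  exists (\matrix_(k, l) f (tperm 0 i k, tperm 0 j l)) => k l.
  by rewrite !A1E mxE !tpermL; apply: (Hf (_, _)).
pose a := A1 0 0; pose U := ursubmx W; pose V := dlsubmx W.
have EU : s *: ursubmx A1 = a *: U by apply/matrixP => k l; rewrite !mxE HW mulrC.
have EV : s *: dlsubmx A1 = a *: V by apply/matrixP => k l; rewrite !mxE HW mulrC.
have Ea : ulsubmx A1 = a%:M.
  by rewrite [LHS]mx11_scalar !mxE; congr (A1 _ _)%:M; apply/val_inj.
pose P1 := block_mx 1%:M 0 (- V) s%:M; pose Q1 := block_mx 1%:M (- U) 0 s%:M.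
have [E EA] : exists E, P1 *m A1 *m Q1 = block_mx a%:M 0 0 E.
  exists (s *: (- V *m ursubmx A1 + s *: drsubmx A1)).
  rewrite -{1}[A1]submxK Ea !mulmx_block.
  rewrite !(mul1mx, mulmx1, mul0mx, mulmx0, add0r, addr0).
  rewrite !mul_mx_scalar !mul_scalar_mx EU EV !scalerN !addNr mul0mx add0r.
  by [].
have [s1 [t1 [Ms1 Mt1 /(@diag_upto_block _ _ a%:M)]]] := IH _ E; rewrite -EA A1def.
move/(diag_upto_equiv (inv_upto_lower s V) (inv_upto_upper s U)).
move/(diag_upto_equiv (inv_upto_tperm 0 i) (inv_upto_tperm 0 j)).
rewrite mulr1 mul1r => diagA; exists (s1 * s), (s * t1).
by split=> //; apply: nMM.
Qed.

(** After diagonalizing [A], let [c i] generate the annihilator of the diagonal entry [b i], and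
    [d i] that of [c i], up to scalars. The rows of [B] and of diag(c) [P] then span the same module
    up to scalars, so generators of the kernel of diag(c), namely diag(d), yield generators of the
    kernel of [B]. *)
Lemma ker_fg_local m n p (A : 'M[R]_(m, n)) (B : 'M[R]_(p, m)) :
  gens_ker B A ->
  (forall P P' Q Q' s t i, ~ M s -> ~ M t ->
    inv_upto s P P' -> inv_upto t Q Q' -> is_diag_mx (P *m A *m Q) ->
    let b := \sum_j (P *m A *m Q) i j in
    forall r c, ~ M r -> c * b = 0 ->
      (forall x, x * b = 0 -> exists u, r * x = u * c) ->
    exists r' d, [/\ ~ M r', d * c = 0 & forall x, x * c = 0 -> exists u, r' * x = u * d]) ->
  exists2 s, ~ M s & ker_fg_upto B s.
Proof.
move=> kerA annP.
have [s [t [Ms Mt [P [P' [Q [Q' [invP invQ diagA]]]]]]]] := arithmetic_diag_local A.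
have {}annP i := annP P P' Q Q' s t i Ms Mt invP invQ diagA.
move: annP diagA; move defD: (P *m A *m Q) => D annP diagA.
(* The row sum is the diagonal entry, and it is 0 when row [i] lies beyond the last column. *)
pose b i := \sum_j D i j.
have DE (i : 'I_m) (j : 'I_n) : i = j :> nat -> D i j = b i.
  move=> ij; rewrite /b (bigD1 j) //= big1 ?addr0 // => k kj.
  by apply: (is_diag_mxP diagA); rewrite ij eq_sym.
have D0 i x : x * b i = 0 -> exists w, t *: (x *: row i P) = w *m B.
  move=> xb; apply/kerA; have E : x *: row i D = 0.
    apply/rowP => j; rewrite !mxE; have [ij|ij] := eqVneq (i : nat) j.
      by rewrite (DE _ _ ij).
    by rewrite (is_diag_mxP diagA) // mulr0.
  have QQ' : Q *m Q' = t%:M by case: invQ.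
  rewrite -!scalemxAl -row_mul scalerA mulrC -scalerA.
  have -> : t *: row i (P *m A) = row i D *m Q'.
    by rewrite -row_mul -defD -mulmxA QQ' mul_mx_scalar linearZ.
  by rewrite scalemxAl E mul0mx.
have BPb k i : (B *m P') k i * b i = 0.
  have BPD : B *m P' *m D = 0.
    case: invP => _ P'P; rewrite -defD !mulmxA -(mulmxA B) P'P mul_mx_scalar.
    by rewrite -!scalemxAl (gens_ker_mul0 kerA) mul0mx scaler0.
  rewrite mulr_sumr big1 // => j _; have [ij|ij] := eqVneq (i : nat) j.
    move/matrixP/(_ k j): BPD; rewrite !mxE (bigD1 i) //= big1 ?addr0 ?mxE // => l li.
    by rewrite [D l j](is_diag_mxP diagA) ?mulr0 // -ij.
  by rewrite (is_diag_mxP diagA) // mulr0.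
pose F i r := exists c d, [/\ c * b i = 0, forall k, exists u, r * (B *m P') k i = u * c,
  d * c = 0 & forall x, x * c = 0 -> exists u, r * x = u * d].
have [|i|r Mr /choice[c /choice[d Hcd]]] := @local_common _ F.
- move=> i a r [c [d [cb Hc dc Hd]]]; exists c, d; split=> //.
    by move=> k; have [u E] := Hc k; exists (a * u); rewrite -mulrA E mulrA.
  by move=> x /Hd[u E]; exists (a * u); rewrite -mulrA E mulrA.
(* Column [i] of [B *m P'] generates the annihilator of [b i] up to a scalar, so its pivot is a
   single generator. The extra index [None], with value 0, covers [p = 0]. *)
- pose f k := if k is Some k then (B *m P') k i else 0.
  have [j [r [Mr Hr]]] := arithmetic_local_pivot maxM arithR f None.
  have cb : f j * b i = 0 by case: j {Hr} => [k|] /=; rewrite ?BPb ?mul0r.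
  have annb x : x * b i = 0 -> exists u, (r * t * s) * x = u * f j.
    move=> /D0[w Ew]; have [g Hg] := choice (fun k => Hr (Some k)).
    exists (\sum_k w 0 k * g k); case: invP => PP' _.
    have : (t *: (x *: row i P) *m P') 0 i = (w *m (B *m P')) 0 i by rewrite Ew mulmxA.
    rewrite -!scalemxAl -row_mul PP' !mxE eqxx mulr1n mulr_suml => E.
    transitivity (r * (t * (x * s))); first by ring.
    by rewrite E mulr_sumr; apply: eq_bigr => k _; rewrite mulrCA Hg mulrA.
  have Mrts : ~ M (r * t * s) by do 2?apply: nMM.
  have [r' [d [Mr' dc Hd]]] := annP i _ _ Mrts cb annb.
  exists (r' * r); first exact: nMM.
  exists (f j), d; split=> // [k|x xc].
    by have [u E] := Hr (Some k); exists (r' * u); rewrite -mulrA E mulrA.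
  by have [u E] := Hd x xc; exists (r * u); rewrite mulrAC E; ring.
have [X HX] : exists X : 'M_(p, m), r *: (B *m P') = X *m diag_mx (\row_i c i).
  have /choice[g Hg] ki : exists u, r * (B *m P') ki.1 ki.2 = u * c ki.2.
    by have [_ + _ _] := Hcd ki.2; apply.
  exists (\matrix_(k, i) g (k, i)); apply/matrixP => k i.
  by rewrite mul_mx_diag [LHS]mxE; have /= -> := Hg (k, i); rewrite !mxE.
have [Y HY] : exists Y : 'M_(m, p), t *: (diag_mx (\row_i c i) *m P) = Y *m B.
  have /choice[g Hg] i : exists w, t *: (c i *: row i P) = w *m B.
    by apply: D0; have [] := Hcd i.
  exists (\matrix_i g i); apply/row_matrixP => i.
  by rewrite row_mul rowK -Hg linearZ /=; congr (_ *: _); apply/rowP => j; rewrite mul_diag_mx !mxE.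
have trsB : (t * r * s) *: B = X *m Y *m B.
  have [_ P'P] := invP.
  rewrite -[RHS]mulmxA -HY -scalemxAr mulmxA -HX -!scalemxAl -mulmxA P'P mul_mx_scalar.
  by rewrite !scalerA.
exists (r * (t * r * s)); first by do !apply: (nMM).
(* The first block records the defect of the round trip through [X] and [Y]; the second pulls the
   kernel of diag(c) back along [Y]. *)
exists (p + m)%N, (col_mx ((t * r * s)%:M - X *m Y) (diag_mx (\row_i d i) *m Y)).
split.
  rewrite mul_col_mx mulmxBl mul_scalar_mx trsB subrr -mulmxA -HY -scalemxAr mulmxA.
  rewrite mulmx_diag; set Z := diag_mx _; suff -> : Z = 0.
    by rewrite mul0mx scaler0 col_mx0.
  apply/matrixP => i j; rewrite !mxE; have [_ _ -> _] := Hcd i; exact: mul0rn.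
move=> v vB; have vXc i : (v *m X) 0 i * c i = 0.
  have : v *m X *m diag_mx (\row_i c i) = 0.
    by rewrite -mulmxA -HX -scalemxAr mulmxA vB mul0mx scaler0.
  by move/rowP/(_ i); rewrite mul_mx_diag !mxE.
have /choice[u Hu] i : exists u, r * (v *m X) 0 i = u * d i.
  by have [_ _ _] := Hcd i; apply.
exists (row_mx (r *: v) (\row_i u i)); rewrite mul_row_col mulmxBr mul_mx_scalar !mulmxA.
have <- : r *: v *m X = (\row_i u i) *m diag_mx (\row_i d i).
  by apply/rowP => i; rewrite mul_mx_diag -scalemxAl !mxE -Hu mxE.
by rewrite subrK scalerA mulrC.
Qed.

End Local.

(** * Finite generation of the next syzygy over the whole ring *)

Hypothesis arithR : arithmetic R.

(** Since the rows of [A] generate a kernel, each diagonal entry [b] generates its own double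
    annihilator up to scalars. Hence (0 : c) is (b) up to scalars, and [d = b] serves in the local
    criterion. *)
Lemma arithmetic_syzygy_fg m n p q (A0 : 'M[R]_(n, q)) (A : 'M[R]_(m, n)) (B : 'M[R]_(p, m)) :
  gens_ker A A0 -> gens_ker B A -> exists k (N : 'M[R]_(k, p)), gens_ker N B.
Proof.
move=> kerA0 kerA; apply: ker_fg_upto1.
apply: (ideal_local_global (ker_fg_upto_ideal B)) => M maxM; apply: (ker_fg_local maxM arithR kerA).
have nMM := maximal_ideal_prime maxM.
move=> P P' Q Q' s t i Ms Mt [PP' P'P] [QQ' Q'Q].
move defD: (P *m A *m Q) => D diagA b r c Mr cb annb.
have [t' Mt' hb] : exists2 t', ~ M t' & forall e, e * c = 0 -> exists u, t' * e = u * b.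
  have ann e x : e * c = 0 -> x * b = 0 -> e * r * x = 0.
    by move=> ec /annb[u E]; rewrite -mulrA E mulrCA ec mulr0.
  have [lt_in|le_ni] := ltnP i n; last first.
    (* In a row beyond the last column [b = 0], so 1 annihilates [b] and [e * r = 0]. *)
    have b0 : b = 0.
      rewrite /b big1 // => j _; rewrite (is_diag_mxP diagA) // neq_ltn.
      by rewrite (leq_trans (ltn_ord j) le_ni) orbT.
    exists r => // e ec; exists 0; rewrite mul0r mulrC -[LHS]mulr1 ann //.
    by rewrite b0 mulr0.
  pose j := Ordinal lt_in; have bE : b = D i j.
    rewrite /b (bigD1 j) //= big1 ?addr0 // => k kj.
    by rewrite (is_diag_mxP diagA) // eq_sym.
  exists (s * t * r) => [|e ec]; first by do 2?apply: (nMM).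
  have DQA0 : D *m Q' *m A0 = 0.
    rewrite -defD -!(mulmxA _ Q) QQ' mul_mx_scalar -scalemxAl -mulmxA (gens_ker_mul0 kerA0).
    by rewrite mulmx0 scaler0.
  have bQA0 k : (Q' *m A0) j k * b = 0.
    move/matrixP/(_ i k): DQA0; rewrite -mulmxA mxE (bigD1 j) //= big1 ?addr0 => [|l lj].
      by rewrite bE mulrC => ->; rewrite mxE.
    by rewrite (is_diag_mxP diagA) ?mul0r // eq_sym.
  (* The entries of row [j] of [Q' *m A0] kill [b], so [e * r] kills them; exactness then writes
     [e * r] times row [j] of [Q'] as a combination of rows of [A]. *)
  have : (e * r) *: row j Q' *m A0 = 0.
    by apply/rowP => k; rewrite -scalemxAl -row_mul !mxE -[RHS](ann _ _ ec (bQA0 k)) mxE.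
  move=> /kerA0[w Ew]; exists ((w *m P') 0 i).
  (* Multiplying by [Q] and inserting [P' *m P] returns to diagonal coordinates, where entry [j]
     exhibits a multiple of [b]. *)
  have E : (s * t * (e * r)) *: delta_mx 0 j = w *m P' *m D.
    rewrite -defD !mulmxA -(mulmxA w) P'P mul_mx_scalar -!scalemxAl -Ew -!scalemxAl -row_mul Q'Q.
    by rewrite rowE mul_mx_scalar !scalerA; congr (_ *: _); ring.
  move/rowP/(_ j): E; rewrite mxE mxE !eqxx mulr1 => E.
  transitivity (s * t * (e * r)); first by ring.
  rewrite E mxE (bigD1 i) //= big1 ?addr0 ?bE // => l li.
  by rewrite [D l j](is_diag_mxP diagA) ?mulr0.
exists (t' * r), b; split; [exact: nMM | by rewrite mulrC |].
exact: (ann_ann arithR annb hb).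
Qed.

(** Here [d] comes from [reduced_ann_ann], so one exact step is enough. *)
Lemma reduced_arithmetic_syzygy_fg m n p (A : 'M[R]_(m, n)) (B : 'M[R]_(p, m)) :
  reduced R -> gens_ker B A -> exists k (N : 'M[R]_(k, p)), gens_ker N B.
Proof.
move=> redR kerA; apply: ker_fg_upto1.
apply: (ideal_local_global (ker_fg_upto_ideal B)) => M maxM; apply: (ker_fg_local maxM arithR kerA).
move=> P P' Q Q' s t i Ms Mt _ _ diagA b r c Mr cb annb.
by have [d [dc Hd]] := reduced_ann_ann arithR redR cb annb; exists r, d.
Qed.

End Matrices.

(** * From an invariant of syzygies to infinite presentations *)

Section Resolutions.
Variable R : comPzRingType.

(** An invariant [good] that gives a finitely generated kernel and passes to its generators can be
    iterated forever. *)
Lemma lambda_inf_of_syzygies (E : lmodType R)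
    (good : forall m n, 'M[R]_(m, n) -> Prop) m n (A : 'M[R]_(m, n))
    (g : {linear 'rV[R]_n -> E}) :
  (forall p q (B : 'M[R]_(p, q)), good _ _ B ->
    exists k (N : 'M[R]_(k, p)), gens_ker N B /\ good _ _ N) ->
  good _ _ A -> (forall e, exists v, g v = e) ->
  (forall v, g v = 0 <-> exists w, v = w *m A) -> lambda_inf E.
Proof.
move=> goodS goodA surjg kerg d.
(* The sizes change at each step, so the iteration runs on matrices bundled with their sizes and the
   invariant. *)
pose state := {p & {q & {B : 'M[R]_(p, q) | good _ _ B}}}.
pose rows (x : state) := tag x.
pose cols (x : state) := tag (tagged x).
pose mat (x : state) : 'M_(rows x, cols x) := sval (tagged (tagged x)).
have syz (x : state) : {k & {N : 'M[R]_(k, rows x) | gens_ker N (mat x) /\ good _ _ N}}.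
  have [k kP] := cid (goodS _ _ (mat x) (svalP (tagged (tagged x)))).
  by exists k; apply: cid.
pose next (x : state) : state :=
  Tagged _ (Tagged (fun q => {B : 'M_(_, q) | good _ _ B})
    (exist _ (sval (tagged (syz x))) (proj2 (svalP (tagged (syz x)))))).
pose x0 : state := Tagged _ (Tagged (fun q => {B : 'M_(_, q) | good _ _ B}) (exist _ A goodA)).
(* [cols (next x)] is convertible to [rows x], so the matrices compose without casts. *)
exists (fun i => cols (iter i next x0)), (fun i => mat (iter i next x0)), g.
split=> // i _; exact: (proj1 (svalP (tagged (syz (iter i next x0))))).
Qed.

End Resolutions.

Theorem theorem2p1 (R : comPzRingType) :
  arithmetic R ->
  lambda_dim_le R 3 /\ (reduced R -> lambda_dim_le R 2).
Proof.
move=> arithR; split=> [|redR].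
  exists 3 => // E [r [A [g [surjg kerg exA]]]].
  (* The invariant is that the next two kernels are finitely generated; the syzygy lemma supplies
     the third, which renews it. *)
  pose good m n (B : 'M[R]_(m, n)) := exists k l (N : 'M[R]_(k, m)) (L : 'M[R]_(l, k)),
    gens_ker N B /\ gens_ker L N.
  apply: (@lambda_inf_of_syzygies R E good _ _ (A 0) g) => //; last exact: kerg.
    move=> p q B [k [l [N [L [NB LN]]]]].
    have [j [K KL]] := arithmetic_syzygy_fg arithR NB LN.
    by exists k, N; split=> //; exists l, j, L, K.
  by exists (r 2), (r 3), (A 1), (A 2); split; apply: exA.
exists 2 => // E [r [A [g [surjg kerg exA]]]].
(* In the reduced case one finitely generated kernel suffices as invariant. *)
pose good m n (B : 'M[R]_(m, n)) := exists k (N : 'M[R]_(k, m)), gens_ker N B.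
apply: (@lambda_inf_of_syzygies R E good _ _ (A 0) g) => //; last exact: kerg.
  move=> p q B [k [N NB]]; exists k, N; split=> //.
  exact: (reduced_arithmetic_syzygy_fg arithR redR NB).
by exists (r 2), (A 1); apply: exA.
Qed.
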